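(* Suppose that the noiseless phase retrieval problem $|a_i^*x|=b_i$ $(i=1,\dots,m)$ has sampling vectors satisfying Assumption 1 (stated in the context), and let $(x^k,y^k,\lambda^k,\nu^k)_{k\ge 0}$ be generated by the GPS iteration with $g=0$. There is $\epsilon_3$ with $0<\epsilon_3<b_{\min}/6$ (small enough) such that, if $\|z_{\mathrm{DR}}^1-z^{\natural}\|\le\epsilon_3$, then there exists a constant $0<\gamma<1$ such that for all $k\ge 1$ $$\operatorname{dist}(x^k,x^{\natural})\le\gamma^{k-1}\|z_{\mathrm{DR}}^1-z_*^1\|\le\gamma^{k-1}\|z_{\mathrm{DR}}^1-z^{\natural}\|,$$ where $z_{\mathrm{DR}}^k=\begin{pmatrix}\lambda^k+x^k\\ \nu^k+y^k\end{pmatrix}$ and $z_*^k=P_{\mathcal F}z_{\mathrm{DR}}^k$.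
   Context: Setting. $A=[a_1,\dots,a_m]\in\mathbb{C}^{n\times m}$, $A^*$ is its conjugate transpose, $m\ge n$. $|\cdot|$, products $\circ$, quotients and inequalities of vectors are entrywise, with the convention $z_i/|z_i|=0$ if $z_i=0$. Norms are Euclidean. $b\in\mathbb{R}^m$ is the vector of measurements, $b_{\min}=\min_i b_i>0$. $x^{\natural}$ is the solution of $|A^*x|=b$, $y^{\natural}=A^*x^{\natural}$ (so $|y^{\natural}|=b$), $z^{\natural}=(x^{\natural},y^{\natural})\in\mathbb{C}^{n+m}$. Assumption 1. (i) $A^*$ has full column rank. (ii) The solution of the phase retrieval problem $|a_i^*x|=b_i$, $i=1,\dots,m$, is unique up to the trivial ambiguities, including translation shift, mirror flipping and global phase shift (multiplication by a unimodular scalar); all of these are the general case for Fourier measurements, while global phase is the only ambiguity for Gaussian measurements; the solution up to these ambiguities is denoted $x^{\natural}$. (iii) The solution of the magnitude retrieval problem: find $x\in\mathbb{C}^n$ with $\frac{a_i^*x}{|a_i^*x|}=\pm\frac{a_i^*x^{\natural}}{|a_i^*x^{\natural}|}$ for $i=1,\dots,m$ (the sign may depend on $i$), is unique up to a constant magnitude factor, i.e. its solutions are $cx^{\natural}$, $c\in\mathbb{R}\setminus\{0\}$. GPS iteration with $g=0$. Let $\Pi_{A^*}$ be the orthogonal projection of $\mathbb{C}^{n+m}$ onto the graph $\{(x,y): A^*x=y\}$ and $\operatorname{prox}_f(y)=b\circ\frac{y}{|y|}$. Given $x^0,\lambda^0\in\mathbb{C}^n$ and $y^0,\nu^0\in\mathbb{C}^m$,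 for $k\ge0$: $(x^{k+1/2},y^{k+1/2})=\Pi_{A^*}(x^k-\lambda^k,y^k-\nu^k)$; $x^{k+1}=x^{k+1/2}+\lambda^k$, $y^{k+1}=\operatorname{prox}_f(y^{k+1/2}+\nu^k)$; $\lambda^{k+1}=\lambda^k+x^{k+1/2}-x^{k+1}$, $\nu^{k+1}=\nu^k+y^{k+1/2}-y^{k+1}$. Define $$\mathcal F=\left\{\begin{pmatrix}\alpha x^{\natural}\\ \alpha(b+\theta)\circ\frac{y^{\natural}}{|y^{\natural}|}\end{pmatrix}: |\alpha|=1,\ \theta\in\mathbb{R}^m,\ A\Big(\theta\circ\frac{y^{\natural}}{|y^{\natural}|}\Big)=0,\ b+\theta\ge0\right\},$$ $P_{\mathcal F}z\in\arg\min_{w\in\mathcal F}\|w-z\|$, and $\operatorname{dist}(x,x^{\natural})=\min_{|\alpha|=1}\|x-\alpha x^{\natural}\|$. *)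

(* Defs.v *)
From HB Require Import structures.
From mathcomp Require Export all_boot all_order all_algebra.
From mathcomp Require Export complex.
From mathcomp Require Export boolp classical_sets reals.

Set Implicit Arguments.
Unset Strict Implicit.
Unset Printing Implicit Defensive.

Import Order.TTheory GRing.Theory Num.Theory.
Local Open Scope ring_scope.
Local Open Scope sesquilinear_scope.
Local Open Scope classical_set_scope.

Section Defs.
Context {R : realType}.
Local Notation C := R[i].

(* The norm of [R[i]] takes its values in [R[i]]; [Normc.normc] is the
   [R]-valued modulus, which is used wherever reals are compared. *)
Definition absv p (v : 'cV[C]_p) : 'cV[R]_p :=
  map_mx (@ComplexField.Normc.normc R) v.

Definition norm2 p (v : 'cV[C]_p) : R :=
  Num.sqrt (\sum_i (absv v i 0) ^+ 2).

Definition scalev p (r : 'cV[R]_p) (v : 'cV[C]_p) : 'cV[C]_p :=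
  map2_mx (fun (s : R) (z : C) => s%:C%C * z) r v.

(* The convention [z / |z| = 0] for [z = 0] is that of division in a field. *)
Definition phasev p (v : 'cV[C]_p) : 'cV[C]_p :=
  map_mx (fun z : C => z / `|z|) v.

Definition is_min_entry p (b : 'cV[R]_p) (r : R) : Prop :=
  (exists i, b i 0 = r) /\ (forall i, r <= b i 0).

Definition is_argmin_dist p (S : set 'cV[C]_p) (z w : 'cV[C]_p) : Prop :=
  S w /\ forall v, S v -> norm2 (w - z) <= norm2 (v - z).

Definition is_orth_proj p (S : set 'cV[C]_p) (z w : 'cV[C]_p) : Prop :=
  S w /\ forall v, S v -> v^t* *m (z - w) = 0.

(* The minimum over the (compact) unit circle is attained, so it is the [inf]. *)
Definition phase_dist p (x x0 : 'cV[C]_p) : R :=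
  inf [set norm2 (x - alpha *: x0) | alpha in [set a : C | `|a| = 1]].

(* Signals live on a grid: a finite abelian group [G] (such as Z/n, or
   Z/n1 x Z/n2 for images) whose points number the coordinates through [pos].
   Shifts are periodic; a shift or flip of a signal inside a zero-padded window
   is of this form too.  For Fourier magnitudes of complex signals mirror
   flipping comes with a conjugation, for real signals it needs none; both are
   allowed, which can only weaken the uniqueness assumption below. *)
Inductive trivially_equivalent n (G : finZmodType) (pos : 'I_n -> G)
    (x : 'cV[C]_n) : 'cV[C]_n -> Prop :=
| TrivRefl : trivially_equivalent pos x x
| TrivPhase (alpha : C) (y : 'cV[C]_n) : `|alpha| = 1 ->
    trivially_equivalent pos x y -> trivially_equivalent pos x (alpha *: y)
| TrivShift (s : G) (y y' : 'cV[C]_n) : (forall i j, pos j = pos i + s -> y' i 0 = y j 0) ->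
    trivially_equivalent pos x y -> trivially_equivalent pos x y'
| TrivFlip (y y' : 'cV[C]_n) : (forall i j, pos j = - pos i -> y' i 0 = y j 0) ->
    trivially_equivalent pos x y -> trivially_equivalent pos x y'
| TrivConjFlip (y y' : 'cV[C]_n) : (forall i j, pos j = - pos i -> y' i 0 = Num.conj (y j 0)) ->
    trivially_equivalent pos x y -> trivially_equivalent pos x y'.

(* With [a_i] the columns of [A], the entries of [A^t* *m x] are the [a_i^* x].
   In [phase_unique] only one direction is required:
   which ambiguities do preserve the measurements depends on [A] (for Gaussian
   measurements, only the global phase does). *)
Record Assumption1 n m (A : 'M[C]_(n, m)) (b : 'cV[R]_m) (G : finZmodType)
    (pos : 'I_n -> G) (xn : 'cV[C]_n) : Prop := {
  full_column_rank : \rank (A^t*) = n;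
  phase_unique : forall x : 'cV[C]_n,
    absv (A^t* *m x) = b -> trivially_equivalent pos xn x;
  magnitude_unique : forall x : 'cV[C]_n,
    (forall i, phasev (A^t* *m x) i 0 = phasev (A^t* *m xn) i 0 \/
               phasev (A^t* *m x) i 0 = - phasev (A^t* *m xn) i 0) <->
    (exists2 c : R, c != 0 & x = c%:C%C *: xn)
}.

Definition graph n m (A : 'M[C]_(n, m)) : set 'cV[C]_(n + m) :=
  [set z | A^t* *m usubmx z = dsubmx z].

Definition prox m (b : 'cV[R]_m) (y : 'cV[C]_m) : 'cV[C]_m :=
  scalev b (phasev y).

(* [xh k], [yh k] are the half-step iterates x^{k+1/2}, y^{k+1/2}. *)
Definition GPS n m (A : 'M[C]_(n, m)) (b : 'cV[R]_m)
    (x : nat -> 'cV[C]_n) (y : nat -> 'cV[C]_m)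
    (lam : nat -> 'cV[C]_n) (nu : nat -> 'cV[C]_m) : Prop :=
  exists (xh : nat -> 'cV[C]_n) (yh : nat -> 'cV[C]_m), forall k : nat,
    [/\ is_orth_proj (graph A) (col_mx (x k - lam k) (y k - nu k))
                               (col_mx (xh k) (yh k)),
        x k.+1 = xh k + lam k,
        y k.+1 = prox b (yh k + nu k),
        lam k.+1 = lam k + xh k - x k.+1
      & nu k.+1 = nu k + yh k - y k.+1].

Definition calF n m (A : 'M[C]_(n, m)) (b : 'cV[R]_m) (xn : 'cV[C]_n)
    (yn : 'cV[C]_m) : set 'cV[C]_(n + m) :=
  [set z | exists (alpha : C) (theta : 'cV[R]_m),
    [/\ `|alpha| = 1,
        A *m scalev theta (phasev yn) = 0,
        (forall i, 0 <= (b + theta) i 0)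
      & z = col_mx (alpha *: xn) (alpha *: scalev (b + theta) (phasev yn))]].

End Defs.

(* Main.v *)
From HB Require Import structures.
Require Import Defs.
From mathcomp Require Import ring lra.
Import Order.TTheory GRing.Theory Num.Theory.
Local Open Scope ring_scope.
Local Open Scope sesquilinear_scope.

(** From the second iterate on the primal multiplier is zero, and
    [z = (x, w)] with [w = nu + y] follows the Douglas-Rachford recursion for
    the graph of [A^t*] and the torus [|y| = b], whose projection is [prox].
    Every point of [calF] close to the solution is a fixed point, and one
    iteration shrinks the distance to the nearest such point by a uniform
    factor [gamma < 1].

    The factor comes from an exact energy balance ([dr_step_energy]).  Let [d]
    be the displacement from a fixed point, split along the phases of [yn] into
    a radial and a tangential part.  For the linearised torus projection the
    iteration loses exactly the squared norm of a vector [g] that bounds two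
    residuals: the image under [A] of the radial part, and the defect of the
    signal and the tangential part from lying on the graph ([residual]).
    Vanishing residuals mean that the radial part is a dual direction of
    [calF], while the tangential part belongs to a signal whose measurements
    are [ii] times real multiples of the true phases; by uniqueness of
    magnitude retrieval that signal is the direction of the global phase
    ([tangential_kernel]).  So the kernel of the residual is the tangent space
    of [calF] at the solution.  At a nearest point the displacement is
    orthogonal to the tangent space of [calF] there ([nearest_orth_line],
    [nearest_orth_phase]), which differs from the former by an angle of the
    order of the dual offset [theta].  With the linear-algebra bound
    [dist_kernel_bound] this gives [|d| <= K * |residual d|]
    ([residual_coercive]), hence a loss of a fixed fraction of [|d|^2].

    Close to the solution the nonlinearity of [prox] only adds an error that is
    a small multiple of [|d|] ([circle_projection_expansion]), so the contraction
    survives for nearby points ([unit_phase_contraction]).  All objects are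
    invariant under multiplication by a unimodular scalar, so the nearest point
    may be assumed to have phase one ([dr_step_contraction]).

    Finally, the nearest points move by at most [2 * gamma * D] in a step that
    starts at distance [D] from [calF].  The drift is summable: with
    [K = 2 / (1 - gamma)], the distance of the nearest point to the solution
    plus [K * D] never increases, which keeps all iterates in the region of
    contraction. *)

Local Notation rl := (@complex.Re _).
Local Notation im := (@complex.Im _).
Local Notation modc := (@ComplexField.Normc.normc _).
Local Notation toC := (real_complex _).
Local Notation ii := ('i%C).

(** * The real inner product on complex vectors *)

Lemma modc_sqr {R : realType} (z : R[i]) : modc z ^+ 2 = rl z ^+ 2 + im z ^+ 2.
Proof. by case: z => a b /=; rewrite sqr_sqrtr // addr_ge0 ?sqr_ge0. Qed.

Lemma modc_ge0 {R : realType} (z : R[i]) : 0 <= modc z.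
Proof. by case: z => a b /=; rewrite sqrtr_ge0. Qed.

Lemma modcE {R : realType} (z : R[i]) : `|z| = toC (modc z).
Proof. by case: z. Qed.

Lemma modc1 {R : realType} (z : R[i]) : `|z| = 1 -> modc z = 1.
Proof. by rewrite modcE => -[]. Qed.

Definition rdot {R : realType} {p} (u v : 'cV[R[i]]_p) : R :=
  \sum_i (rl (u i 0) * rl (v i 0) + im (u i 0) * im (v i 0)).

Lemma norm2E {R : realType} p (v : 'cV[R[i]]_p) : norm2 v = Num.sqrt (rdot v v).
Proof.
congr Num.sqrt; apply: eq_bigr => i _.
by rewrite mxE modc_sqr !expr2.
Qed.

Lemma rdot_ge0 {R : realType} p (v : 'cV[R[i]]_p) : 0 <= rdot v v.
Proof. by apply: sumr_ge0 => i _; rewrite -!expr2 addr_ge0 ?sqr_ge0. Qed.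

Lemma norm2_ge0 {R : realType} p (v : 'cV[R[i]]_p) : 0 <= norm2 v.
Proof. exact: sqrtr_ge0. Qed.

Lemma norm2_sqr {R : realType} p (v : 'cV[R[i]]_p) : norm2 v ^+ 2 = rdot v v.
Proof. by rewrite norm2E sqr_sqrtr // rdot_ge0. Qed.

Lemma norm2_sum {R : realType} p (v : 'cV[R[i]]_p) :
  norm2 v ^+ 2 = \sum_i modc (v i 0) ^+ 2.
Proof.
by rewrite norm2_sqr; apply: eq_bigr => i _; rewrite modc_sqr !expr2.
Qed.

Lemma rdotC {R : realType} p (u v : 'cV[R[i]]_p) : rdot u v = rdot v u.
Proof. by apply: eq_bigr => i _; rewrite mulrC [im _ * _]mulrC. Qed.

Lemma rdotDl {R : realType} p (u v w : 'cV[R[i]]_p) :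
  rdot (u + v) w = rdot u w + rdot v w.
Proof.
rewrite /rdot -big_split; apply: eq_bigr => i _; rewrite mxE !raddfD /=.
by ring.
Qed.

Lemma rdotZl {R : realType} p (s : R) (u v : 'cV[R[i]]_p) :
  rdot (toC s *: u) v = s * rdot u v.
Proof.
rewrite /rdot mulr_sumr; apply: eq_bigr => i _; rewrite mxE.
by case: (u i 0) => a c /=; ring.
Qed.

Lemma rdotNl {R : realType} p (u v : 'cV[R[i]]_p) : rdot (- u) v = - rdot u v.
Proof.
rewrite /rdot -sumrN; apply: eq_bigr => i _; rewrite mxE.
by case: (u i 0) => a c /=; ring.
Qed.

Lemma rdotBl {R : realType} p (u v w : 'cV[R[i]]_p) :
  rdot (u - v) w = rdot u w - rdot v w.
Proof. by rewrite rdotDl rdotNl. Qed.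

Lemma rdotDr {R : realType} p (u v w : 'cV[R[i]]_p) :
  rdot w (u + v) = rdot w u + rdot w v.
Proof. by rewrite rdotC rdotDl !(rdotC _ w). Qed.

Lemma rdotNr {R : realType} p (u v : 'cV[R[i]]_p) : rdot u (- v) = - rdot u v.
Proof. by rewrite rdotC rdotNl rdotC. Qed.

Lemma rdotZr {R : realType} p (s : R) (u v : 'cV[R[i]]_p) :
  rdot u (toC s *: v) = s * rdot u v.
Proof. by rewrite rdotC rdotZl rdotC. Qed.

Lemma rdotBr {R : realType} p (u v w : 'cV[R[i]]_p) :
  rdot w (u - v) = rdot w u - rdot w v.
Proof. by rewrite rdotDr rdotNr. Qed.

Lemma rdot0l {R : realType} p (v : 'cV[R[i]]_p) : rdot 0 v = 0.
Proof. by rewrite -(subrr v) rdotBl subrr. Qed.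

(** Multiplication by the imaginary unit is a quarter turn. *)
Lemma rdot_iZ {R : realType} p (u : 'cV[R[i]]_p) : rdot u (ii *: u) = 0.
Proof.
rewrite /rdot big1 // => i _; rewrite mxE.
by case: (u i 0) => a c /=; ring.
Qed.

Lemma rdot_col {R : realType} p q (u u' : 'cV[R[i]]_p) (v v' : 'cV[R[i]]_q) :
  rdot (col_mx u v) (col_mx u' v') = rdot u u' + rdot v v'.
Proof.
rewrite /rdot big_split_ord /=; congr (_ + _); apply: eq_bigr => i _.
  by rewrite !col_mxEu.
by rewrite !col_mxEd.
Qed.

Lemma norm2_eq0 {R : realType} p (v : 'cV[R[i]]_p) : norm2 v = 0 -> v = 0.
Proof.
move=> v0; apply/matrixP => i j; rewrite (ord1 j) mxE.
have /eqP := norm2_sum _ v; rewrite v0 expr0n /= eq_sym.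
rewrite psumr_eq0 => [/allP/(_ i (mem_index_enum i))|k _]; last exact: sqr_ge0.
by rewrite /= sqrf_eq0 => /eqP/ComplexField.Normc.eq0_normc.
Qed.

Lemma norm20 {R : realType} p : norm2 (0 : 'cV[R[i]]_p) = 0.
Proof. by rewrite norm2E rdot0l sqrtr0. Qed.

Lemma norm2N {R : realType} p (v : 'cV[R[i]]_p) : norm2 (- v) = norm2 v.
Proof. by rewrite !norm2E rdotNl rdotNr opprK. Qed.

Lemma norm2BC {R : realType} p (u v : 'cV[R[i]]_p) : norm2 (u - v) = norm2 (v - u).
Proof. by rewrite -norm2N opprB. Qed.

Lemma norm2Z {R : realType} p (a : R[i]) (v : 'cV[R[i]]_p) :
  norm2 (a *: v) = modc a * norm2 v.
Proof.
apply/eqP; rewrite -(@eqrXn2 _ 2) ?mulr_ge0 ?norm2_ge0 ?modc_ge0 //.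
rewrite exprMn !norm2_sum mulr_sumr; apply/eqP; apply: eq_bigr => i _.
by rewrite mxE -exprMn ComplexField.Normc.normcM.
Qed.

Lemma norm2Z1 {R : realType} p (a : R[i]) (v : 'cV[R[i]]_p) :
  `|a| = 1 -> norm2 (a *: v) = norm2 v.
Proof. by move=> /modc1 a1; rewrite norm2Z a1 mul1r. Qed.

Lemma norm2_col {R : realType} p q (u : 'cV[R[i]]_p) (v : 'cV[R[i]]_q) :
  norm2 (col_mx u v) ^+ 2 = norm2 u ^+ 2 + norm2 v ^+ 2.
Proof. by rewrite !norm2_sqr rdot_col. Qed.

Lemma norm2_colu {R : realType} p q (u : 'cV[R[i]]_p) (v : 'cV[R[i]]_q) :
  norm2 u <= norm2 (col_mx u v).
Proof.
by rewrite -ler_sqr ?nnegrE ?norm2_ge0 // norm2_col lerDl sqr_ge0.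
Qed.

Lemma norm2_cold {R : realType} p q (u : 'cV[R[i]]_p) (v : 'cV[R[i]]_q) :
  norm2 v <= norm2 (col_mx u v).
Proof.
by rewrite -ler_sqr ?nnegrE ?norm2_ge0 // norm2_col lerDr sqr_ge0.
Qed.

Lemma modc_le_norm2 {R : realType} p (v : 'cV[R[i]]_p) i : modc (v i 0) <= norm2 v.
Proof.
rewrite -ler_sqr ?nnegrE ?norm2_ge0 ?modc_ge0 // norm2_sum (bigD1 i) //= lerDl.
by apply: sumr_ge0 => j _; rewrite sqr_ge0.
Qed.

Lemma norm2_le_entries {R : realType} p (k : R) (u v : 'cV[R[i]]_p) :
  0 <= k -> (forall i, modc (u i 0) <= k * modc (v i 0)) -> norm2 u <= k * norm2 v.
Proof.
move=> k0 h; rewrite -ler_sqr ?nnegrE ?mulr_ge0 ?norm2_ge0 //.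
rewrite exprMn !norm2_sum mulr_sumr; apply: ler_sum => i _.
by rewrite -exprMn ler_sqr ?nnegrE ?mulr_ge0 ?modc_ge0.
Qed.

Lemma rdot_le {R : realType} p (u v : 'cV[R[i]]_p) : `|rdot u v| <= norm2 u * norm2 v.
Proof.
have [v0|v0] := eqVneq (norm2 v) 0.
  by rewrite v0 (norm2_eq0 _ _ v0) rdotC rdot0l normr0 mulr0.
have v0' : 0 < norm2 v by rewrite lt_def v0 norm2_ge0.
rewrite -ler_sqr ?nnegrE ?mulr_ge0 ?norm2_ge0 // real_normK ?num_real //.
have := rdot_ge0 _ (toC (norm2 v ^+ 2) *: u - toC (rdot u v) *: v).
rewrite rdotBl !rdotBr !rdotZl !rdotZr -!norm2_sqr (rdotC _ v u) exprMn.
set a := norm2 u; set b := norm2 v; set c := rdot u v => h.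
have : 0 <= b ^+ 2 * (a ^+ 2 * b ^+ 2 - c ^+ 2) by apply: le_trans h _; lra.
by rewrite pmulr_rge0 ?exprn_gt0 // subr_ge0.
Qed.

Lemma norm2D {R : realType} p (u v : 'cV[R[i]]_p) : norm2 (u + v) <= norm2 u + norm2 v.
Proof.
rewrite -ler_sqr ?nnegrE ?addr_ge0 ?norm2_ge0 // norm2_sqr rdotDl !rdotDr.
rewrite -!norm2_sqr (rdotC _ v u).
have := rdot_le _ u v; have := ler_norm (rdot u v).
set a := norm2 u; set b := norm2 v; set c := rdot u v => h1 h2.
have : c <= a * b by exact: le_trans h2.
by rewrite sqrrD mulr2n; lra.
Qed.

Lemma norm2B {R : realType} p (u v : 'cV[R[i]]_p) : norm2 (u - v) <= norm2 u + norm2 v.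
Proof. by rewrite -(norm2N _ v) norm2D. Qed.

Lemma norm2_triangle {R : realType} p (u v w : 'cV[R[i]]_p) :
  norm2 (u - w) <= norm2 (u - v) + norm2 (v - w).
Proof. by apply: le_trans (norm2D _ _ _); rewrite addrA subrK. Qed.

Lemma norm2_le_sqr {R : realType} p q (u : 'cV[R[i]]_p) (v : 'cV[R[i]]_q) :
  norm2 u <= norm2 v -> norm2 u ^+ 2 <= norm2 v ^+ 2.
Proof. by move=> uv; rewrite ler_sqr ?nnegrE ?norm2_ge0. Qed.

(** * Real-linear maps between complex spaces *)

Definition rlinear {R : realType} {p q} (f : 'cV[R[i]]_p -> 'cV[R[i]]_q) :=
  forall (s : R) u v, f (toC s *: u + v) = toC s *: f u + f v.

Definition realify {R : realType} {p} (v : 'cV[R[i]]_p) : 'rV[R]_(p + p) :=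
  row_mx (\row_i rl (v i 0)) (\row_i im (v i 0)).

Definition complexify {R : realType} {p} (c : 'rV[R]_(p + p)) : 'cV[R[i]]_p :=
  \col_i (c 0 (lshift p i) +i* c 0 (rshift p i))%C.

Lemma realifyK {R : realType} p (v : 'cV[R[i]]_p) : complexify (realify v) = v.
Proof.
apply/matrixP => i j; rewrite (ord1 j) !mxE /= (unsplitK (inl _)) (unsplitK (inr _)).
by rewrite !mxE; case: (v i 0).
Qed.

Lemma complexifyK {R : realType} p (c : 'rV[R]_(p + p)) : realify (complexify c) = c.
Proof.
apply/rowP => k; rewrite !mxE; case: splitP => j kj; rewrite !mxE /=;
  by congr (c _ _); apply: val_inj; rewrite /= kj.
Qed.

Lemma complexify_linear {R : realType} p (s : R) (c d : 'rV[R]_(p + p)) :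
  complexify (s *: c + d) = toC s *: complexify c + complexify d.
Proof.
apply/matrixP => i j; rewrite !mxE; apply/eqP; rewrite eq_complex /=.
by apply/andP; split; apply/eqP; ring.
Qed.

Lemma realify_linear {R : realType} p (s : R) (u v : 'cV[R[i]]_p) :
  realify (toC s *: u + v) = s *: realify u + realify v.
Proof. by rewrite -[RHS]complexifyK complexify_linear !realifyK. Qed.

(** In real coordinates [f] is a matrix, and [pinvmx] provides [h]. *)
Lemma rlinear_pseudo_inverse {R : realType} p q (f : 'cV[R[i]]_p -> 'cV[R[i]]_q) :
  rlinear f -> exists h, rlinear h /\ forall v, f (h (f v)) = f v.
Proof.
move=> fl; pose F (c : 'rV[R]_(p + p)) := realify (f (complexify c)).
have Fl : linear F.
  by move=> s c d; rewrite /F complexify_linear fl realify_linear.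
pose L : {linear 'rV[R]_(p + p) -> 'rV[R]_(q + q)} :=
  HB.pack F (GRing.isLinear.Build R _ _ _ F Fl).
pose M := lin1_mx L.
have fE v : realify (f v) = realify v *m M.
  by rewrite mul_rV_lin1 /= /F realifyK.
exists (fun w => complexify (realify w *m pinvmx M)); split.
  by move=> s u v; rewrite realify_linear mulmxDl -scalemxAl complexify_linear.
move=> v; rewrite -[LHS]realifyK -[RHS]realifyK; congr complexify.
by rewrite fE complexifyK fE mulmxKpV // submxMl.
Qed.

Lemma norm2_sumD {R : realType} p (I : finType) (F : I -> 'cV[R[i]]_p) :
  norm2 (\sum_i F i) <= \sum_i norm2 (F i).
Proof.
elim/big_ind2: _ => [|a x b y ha hb|//]; first by rewrite norm20.
by apply: le_trans (norm2D _ _ _) _; exact: lerD.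
Qed.

Lemma rlinear_bounded {R : realType} p q (f : 'cV[R[i]]_p -> 'cV[R[i]]_q) :
  rlinear f -> exists2 K : R, 1 <= K & forall v, norm2 (f v) <= K * norm2 v.
Proof.
move=> fl.
have f0 : f 0 = 0.
  by have := fl 1 0 0; rewrite rmorph1 !scale1r addr0 -{1}[f 0]addr0 => /addrI.
have fZ s u : f (toC s *: u) = toC s *: f u.
  by rewrite -[_ *: u]addr0 fl f0 addr0.
have fD u v : f (u + v) = f u + f v.
  by have := fl 1 u v; rewrite rmorph1 !scale1r.
have fS (I : finType) (F : I -> 'cV[R[i]]_p) : f (\sum_i F i) = \sum_i f (F i).
  by elim/big_ind2: _ => [|a x b y <- <-|//]; rewrite ?f0 // fD.
pose e i : 'cV[R[i]]_p := delta_mx i 0.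
exists (1 + \sum_i (norm2 (f (e i)) + norm2 (f (ii *: e i)))).
  by rewrite lerDl sumr_ge0 // => i _; rewrite addr_ge0 ?norm2_ge0.
move=> v.
have vE : v = \sum_i (toC (rl (v i 0)) *: e i + toC (im (v i 0)) *: (ii *: e i)).
  rewrite {1}[v]matrix_sum_delta; apply: eq_bigr => i _; rewrite big_ord1.
  rewrite scalerA -scalerDl; congr (_ *: _); rewrite [LHS]complexE.
  by rewrite [ii * _]mulrC.
rewrite {1}vE fS; apply: le_trans (norm2_sumD _ _ _) _.
rewrite mulrDl mul1r mulr_suml -[leLHS]add0r; apply: lerD; first exact: norm2_ge0.
apply: ler_sum => i _; rewrite fD !fZ; apply: le_trans (norm2D _ _ _) _.
rewrite !norm2Z mulrDl ![modc (toC _)]/= !expr0n !addr0 !sqrtr_sqr.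
have hv := modc_le_norm2 _ v i.
have hr : `|rl (v i 0)| <= norm2 v.
  apply: le_trans hv; rewrite -ler_sqr ?nnegrE ?modc_ge0 //.
  by rewrite modc_sqr real_normK ?num_real // lerDl sqr_ge0.
have hi : `|im (v i 0)| <= norm2 v.
  apply: le_trans hv; rewrite -ler_sqr ?nnegrE ?modc_ge0 //.
  by rewrite modc_sqr real_normK ?num_real // lerDr sqr_ge0.
by apply: lerD; rewrite mulrC ler_wpM2l ?norm2_ge0.
Qed.

(** A Hoffman-type bound.  For a pseudo-inverse [h] of [f] the vector
    [v - h (f v)] lies in the kernel, and it is as close to [v] as the norm of
    [h] allows. *)
Lemma dist_kernel_bound {R : realType} p q (f : 'cV[R[i]]_p -> 'cV[R[i]]_q) :
  rlinear f -> exists2 K : R, 1 <= K &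
    forall v, exists2 v0, f v0 = 0 & norm2 (v - v0) <= K * norm2 (f v).
Proof.
move=> fl; have [h [hl fhf]] := rlinear_pseudo_inverse _ _ _ fl.
have [K K1 hK] := rlinear_bounded _ _ _ hl.
exists K => // v; exists (v - h (f v)); last by rewrite opprB addrC subrK.
have := fl (-1) (h (f v)) v; rewrite rmorphN1 !scaleN1r => fB.
by rewrite addrC fB fhf addNr.
Qed.

(** * First-order expansion of the magnitude projection *)

Lemma modc_real {R : realType} (s : R) : modc (toC s) = `|s|.
Proof. by rewrite /= expr0n addr0 sqrtr_sqr. Qed.

Lemma modc_i {R : realType} : modc (ii : R[i]) = 1.
Proof. by rewrite /= expr0n expr1n add0r sqrtr1. Qed.

Lemma modc_le_abs {R : realType} (z : R[i]) : modc z <= `|rl z| + `|im z|.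
Proof.
rewrite -ler_sqr ?nnegrE ?modc_ge0 ?addr_ge0 // modc_sqr sqrrD !real_normK ?num_real //.
by rewrite addrAC lerDl mulrn_wge0 // mulr_ge0.
Qed.

Lemma abs_im_le {R : realType} (z : R[i]) : `|im z| <= modc z.
Proof.
rewrite -ler_sqr ?nnegrE ?modc_ge0 // modc_sqr real_normK ?num_real //.
by rewrite lerDr sqr_ge0.
Qed.

Lemma abs_re_le {R : realType} (z : R[i]) : `|rl z| <= modc z.
Proof.
rewrite -ler_sqr ?nnegrE ?modc_ge0 // modc_sqr real_normK ?num_real //.
by rewrite lerDl sqr_ge0.
Qed.

(** Along a circle of radius [b] the nearest-point map keeps the tangential
    displacement; radial displacements and the offset [beta - b] of the base
    point only enter through products with [h]. *)
Lemma circle_projection_expansion {R : realType} (c h : R[i]) (b beta s : R) :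
  `|c| = 1 -> 0 < b -> `|beta - b| + modc h <= s -> s <= b / 2%:R ->
  modc (toC b * (c * (toC beta + h) / `|c * (toC beta + h)|)
        - toC b * c - c * (toC (im h) * ii)) <= 6%:R * s / b * modc h.
Proof.
move=> c1 b0 hs sb.
pose N : R := modc (toC beta + h).
have hh := modc_ge0 h.
have beta0 : 0 < beta by have := ler_norm (b - beta); rewrite distrC; lra.
have hN : `|N - b| <= s.
  apply: le_trans hs; apply: (@le_trans _ _ (`|beta - b| + `|N - beta|)).
    have -> : N - b = (beta - b) + (N - beta) by ring.
    exact: ler_normD.
  rewrite lerD2l ler_norml; apply/andP; split.
    have := le_normcD (toC beta + h) (- h).
    rewrite addrK modc_real (gtr0_norm beta0) normcN -/N; lra.
  have := le_normcD (toC beta) h.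
  rewrite modc_real (gtr0_norm beta0) -/N; lra.
have Nb : b / 2%:R <= N by move: hN; rewrite ler_norml => /andP[]; lra.
have N0 : 0 < N by lra.
rewrite normrM c1 mul1r modcE -/N.
have -> : toC b * (c * (toC beta + h) / toC N) - toC b * c - c * (toC (im h) * ii)
    = c * (toC b * ((toC beta + h) / toC N) - toC b - toC (im h) * ii) by ring.
rewrite ComplexField.Normc.normcM (modc1 _ c1) mul1r.
have [h1 h2 hE] : exists2 h1, h = (h1 +i* im h)%C & h1 = rl h.
  by exists (rl h) => //; case: (h).
set k := im h in hE *.
have -> : toC b * ((toC beta + h) / toC N) - toC b - toC k * ii
    = ((b * (beta + h1 - N) / N) +i* (k * (b - N) / N))%C.
  rewrite -fmorphV {1}h2; apply/eqP; rewrite eq_complex /=.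
  by apply/andP; split; apply/eqP; field; rewrite gt_eqF.
apply: le_trans (modc_le_abs _) _ => /=.
set x := beta + h1.
have Nx : N ^+ 2 = x ^+ 2 + k ^+ 2.
  by rewrite /N modc_sqr h2 /= add0r.
have kh : `|k| <= modc h by exact: abs_im_le.
have x0 : 0 < x.
  have : `|h1| <= modc h.
    by rewrite hE; exact: abs_re_le.
  have := ler_norm (- h1); rewrite normrN.
  by have := ler_norm (b - beta); rewrite distrC /x; lra.
have xN : x <= N.
  by rewrite -ler_sqr ?nnegrE ?(ltW x0) ?(ltW N0) // Nx lerDl sqr_ge0.
have hs' : modc h <= s by have := normr_ge0 (beta - b); lra.
have iN : N^-1 <= 2%:R / b.
  by rewrite -[_ / b]invf_div lef_pV2 ?posrE // divr_gt0.
have iN0 : 0 < N^-1 by rewrite invr_gt0.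
have k2 : k ^+ 2 <= modc h * s.
  rewrite -[k ^+ 2]real_normK ?num_real // expr2.
  by apply: ler_pM => //; exact: le_trans kh hs'.
have e1 : `|b * (x - N) / N| <= 4%:R * s / b * modc h.
  rewrite normrM normfV (gtr0_norm N0) normrM (gtr0_norm b0) ler0_norm ?subr_le0 //.
  have h1' : N - x <= modc h * s * N^-1.
    rewrite ler_pdivlMr //; apply: le_trans k2.
    have -> : k ^+ 2 = (N - x) * (N + x) by rewrite -subr_sqr Nx; ring.
    by rewrite ler_wpM2l ?subr_ge0 // lerDl ltW.
  rewrite opprB.
  apply: (@le_trans _ _ (b * (modc h * s * N^-1) * N^-1)).
    by rewrite ler_wpM2r ?(ltW iN0) // ler_wpM2l // ltW.
  have -> : 4%:R * s / b * modc h = b * (modc h * s) * ((2%:R / b) * (2%:R / b)).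
    by field; rewrite gt_eqF.
  have -> : b * (modc h * s * N^-1) * N^-1 = b * (modc h * s) * (N^-1 * N^-1) by ring.
  rewrite ler_wpM2l // ?mulr_ge0 ?(ltW b0) //; first exact: le_trans hs'.
  by apply: ler_pM => //; exact: ltW.
have e2 : `|k * (b - N) / N| <= 2%:R * s / b * modc h.
  rewrite normrM normfV (gtr0_norm N0) normrM distrC.
  have -> : 2%:R * s / b * modc h = modc h * s * (2%:R / b) by ring.
  apply: ler_pM => //; first by rewrite mulr_ge0.
  - exact: ltW.
  - exact: ler_pM.
apply: le_trans (lerD e1 e2) _; rewrite -mulrDl ler_wpM2r // -mulrDl.
by rewrite -mulrDl -natrD.
Qed.

(** * Radial and tangential parts along a phase vector *)

Definition unimodular {R : realType} {m} (phi : 'cV[R[i]]_m) := forall i, `|phi i 0| = 1.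

Definition radial {R : realType} {m} (phi eta : 'cV[R[i]]_m) : 'cV[R]_m :=
  \col_i rl (conjc (phi i 0) * eta i 0).

Definition tangential {R : realType} {m} (phi eta : 'cV[R[i]]_m) : 'cV[R]_m :=
  \col_i im (conjc (phi i 0) * eta i 0).

Lemma unimodular_mulJ {R : realType} (c : R[i]) : `|c| = 1 -> c * conjc c = 1.
Proof. by move=> c1; rewrite -sqr_normc c1 expr1n. Qed.

Lemma scalevE {R : realType} m (r : 'cV[R]_m) (v : 'cV[R[i]]_m) i :
  scalev r v i 0 = toC (r i 0) * v i 0.
Proof. by rewrite mxE. Qed.

Lemma scalevD {R : realType} m (r s : 'cV[R]_m) (v : 'cV[R[i]]_m) :
  scalev (r + s) v = scalev r v + scalev s v.
Proof. by apply/matrixP => i j; rewrite (ord1 j) !mxE rmorphD mulrDl. Qed.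

Lemma scalevZ {R : realType} m (k : R) (r : 'cV[R]_m) (v : 'cV[R[i]]_m) :
  scalev (k *: r) v = toC k *: scalev r v.
Proof. by apply/matrixP => i j; rewrite (ord1 j) !mxE rmorphM mulrA. Qed.

Lemma radial_tangentialE {R : realType} m (phi eta : 'cV[R[i]]_m) : unimodular phi ->
  eta = scalev (radial phi eta) phi + ii *: scalev (tangential phi eta) phi.
Proof.
move=> phi1; apply/matrixP => i j; rewrite (ord1 j) !mxE mulrA -mulrDl -complexE.
by rewrite mulrAC [_ * phi i 0]mulrC unimodular_mulJ // mul1r.
Qed.

Lemma rdot_radial_tangential {R : realType} m (phi : 'cV[R[i]]_m) (r s : 'cV[R]_m) :
  rdot (scalev r phi) (ii *: scalev s phi) = 0.
Proof.
rewrite /rdot big1 // => i _; rewrite !mxE.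
by case: (phi i 0) => a c /=; ring.
Qed.

Lemma tangential_linear {R : realType} m (phi u v : 'cV[R[i]]_m) (s : R) :
  tangential phi (toC s *: u + v) = s *: tangential phi u + tangential phi v.
Proof.
apply/matrixP => i j; rewrite !mxE.
by case: (phi i 0) (u i 0) (v i 0) => [a1 a2] [b1 b2] [c1 c2] /=; ring.
Qed.

Lemma map_conj_trmxE {R : realType} n m (A : 'M[R[i]]_(n, m)) i j :
  (A^t*) i j = conjc (A j i).
Proof. by rewrite !mxE. Qed.

Lemma rdotE {R : realType} p (u v : 'cV[R[i]]_p) :
  rdot u v = rl ((u^t* *m v) 0 0).
Proof.
rewrite mxE raddf_sum; apply: eq_bigr => i _; rewrite map_conj_trmxE.
by case: (u i 0) (v i 0) => [a1 a2] [b1 b2] /=; ring.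
Qed.

Lemma adjoint_mulmx {R : realType} n m p (A : 'M[R[i]]_(n, m)) (B : 'M[R[i]]_(m, p)) :
  (A *m B)^t* = B^t* *m A^t*.
Proof. by rewrite trmx_mul map_mxM. Qed.

Lemma adjointK {R : realType} n m (A : 'M[R[i]]_(n, m)) : (A^t*)^t* = A.
Proof. by apply/matrixP => i j; rewrite !map_conj_trmxE conjcK. Qed.

Lemma rdot_adjoint {R : realType} n m (A : 'M[R[i]]_(n, m)) x y :
  rdot (A^t* *m x) y = rdot x (A *m y).
Proof. by rewrite !rdotE adjoint_mulmx adjointK mulmxA. Qed.

(** * The linearised residual and its kernel *)

(** Vanishing of the first block says that the radial part is invisible to the
    graph of [A^t*]; vanishing of the second says that the signal and the
    tangential part lie on that graph. *)
Definition residual {R : realType} {n m} (A : 'M[R[i]]_(n, m)) (phi : 'cV[R[i]]_m)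
    (d : 'cV[R[i]]_(n + m)) : 'cV[R[i]]_(n + m) :=
  col_mx (A *m scalev (radial phi (dsubmx d)) phi)
         (A^t* *m usubmx d - ii *: scalev (tangential phi (dsubmx d)) phi).

Lemma residual_rlinear {R : realType} n m (A : 'M[R[i]]_(n, m)) (phi : 'cV[R[i]]_m) :
  unimodular phi -> rlinear (residual A phi).
Proof.
move=> phi1 s u v; rewrite /residual scale_col_mx add_col_mx.
have lt : ii *: scalev (tangential phi (dsubmx (toC s *: u + v))) phi
   = toC s *: (ii *: scalev (tangential phi (dsubmx u)) phi)
     + ii *: scalev (tangential phi (dsubmx v)) phi.
  rewrite linearD linearZ /= tangential_linear scalevD scalevZ scalerDr.
  by rewrite !scalerA [ii * _]mulrC.
have lr : scalev (radial phi (dsubmx (toC s *: u + v))) phi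
   = toC s *: scalev (radial phi (dsubmx u)) phi + scalev (radial phi (dsubmx v)) phi.
  have rE w := canRL (addrK _) (esym (radial_tangentialE _ phi w phi1)).
  rewrite !rE lt linearD linearZ /= scalerBr opprD addrACA; done.
rewrite lr lt; congr col_mx; first by rewrite mulmxDr scalemxAr.
rewrite linearD linearZ /= mulmxDr -scalemxAr scalerBr opprD addrACA; done.
Qed.

Lemma phase_positive {R : realType} (c : R[i]) (s : R) :
  `|c| = 1 -> 0 < s -> toC s * c / `|toC s * c| = c.
Proof.
move=> c1 s0; rewrite normrM c1 mulr1 modcE modc_real gtr0_norm //.
by rewrite mulrAC divff ?mul1r // eq_complex /= eqxx andbT gt_eqF.
Qed.

(** Adding a large real multiple of [xn] to [- ii *: xi] makes every measured
    phase agree with the true one, so magnitude retrieval applies to the sum.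
    The detour copes with entries of [T] that vanish, whose phase is [0]. *)
Lemma tangential_kernel {R : realType} n m (A : 'M[R[i]]_(n, m)) (b : 'cV[R]_m)
    (bmin : R) (phi : 'cV[R[i]]_m) (xn xi : 'cV[R[i]]_n) (T : 'cV[R]_m) :
  unimodular phi -> 0 < bmin -> (forall i, bmin <= b i 0) ->
  A^t* *m xn = scalev b phi ->
  (forall x : 'cV[R[i]]_n,
    (forall i, phasev (A^t* *m x) i 0 = phasev (A^t* *m xn) i 0) ->
    exists c : R, x = toC c *: xn) ->
  A^t* *m xi = ii *: scalev T phi ->
  exists t : R, xi = toC t *: (ii *: xn).
Proof.
move=> phi1 bmin0 hb hxn hmag hxi.
have [s pos] : exists s : R, forall i, 0 < T i 0 + s * b i 0.
  exists (1 + (\sum_i `|T i 0|) / bmin) => i.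
  have b0 : 0 < b i 0 by exact: lt_le_trans (hb i).
  have Ti : `|T i 0| <= \sum_i `|T i 0|.
    by rewrite (bigD1 i) //= lerDl sumr_ge0.
  have S0 : 0 <= (\sum_i `|T i 0|) / bmin.
    by rewrite divr_ge0 ?(ltW bmin0) // (le_trans _ Ti).
  have : (\sum_i `|T i 0|) <= (\sum_i `|T i 0|) / bmin * b i 0.
    rewrite -[leLHS](divfK (lt0r_neq0 bmin0)); exact: ler_wpM2l.
  have := ler_norm (- T i 0); rewrite normrN mulrDl mul1r; lra.
have [c hc] : exists c : R, - ii *: xi + toC s *: xn = toC c *: xn.
  apply: hmag => i; rewrite [LHS]mxE [RHS]mxE.
  have -> : (A^t* *m (- ii *: xi + toC s *: xn)) i 0 = toC (T i 0 + s * b i 0) * phi i 0.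
    have i2 : - ii * ii = 1 :> R[i] by rewrite mulNr -expr2 sqr_i opprK.
    rewrite mulmxDr -!scalemxAr hxi hxn !mxE !mulrA i2 mul1r.
    by rewrite rmorphD rmorphM -mulrDl.
  have -> : (A^t* *m xn) i 0 = toC (b i 0) * phi i 0 by rewrite hxn scalevE.
  by rewrite !phase_positive // (lt_le_trans bmin0).
exists (c - s).
have {hc} : - ii *: xi = toC (c - s) *: xn.
  by rewrite rmorphB scalerBl -hc addrK.
move=> /(congr1 (fun v => ii *: v)); rewrite !scalerA mulrN -expr2 sqr_i opprK scale1r.
by move=> ->; rewrite [ii * _]mulrC.
Qed.

(** The nearest kernel element [d0] is a phase direction plus a dual direction.
    As [d] is orthogonal to the latter and almost orthogonal to the former,
    [d] cannot be much longer than [d - d0], which the residual controls. *)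
Lemma residual_coercive {R : realType} n m (A : 'M[R[i]]_(n, m)) (b : 'cV[R]_m)
    (bmin : R) (phi : 'cV[R[i]]_m) (xn : 'cV[R[i]]_n) :
  unimodular phi -> 0 < bmin -> (forall i, bmin <= b i 0) ->
  A^t* *m xn = scalev b phi ->
  (forall x : 'cV[R[i]]_n,
    (forall i, phasev (A^t* *m x) i 0 = phasev (A^t* *m xn) i 0) ->
    exists c : R, x = toC c *: xn) ->
  exists2 K : R, 1 <= K & forall d : 'cV[R[i]]_(n + m),
    (forall tau, A *m scalev tau phi = 0 -> rdot d (col_mx 0 (scalev tau phi)) = 0) ->
    `|rdot d (ii *: col_mx xn (scalev b phi))| <= norm2 xn / 4%:R * norm2 d ->
    norm2 d <= K * norm2 (residual A phi d).
Proof.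
move=> phi1 bmin0 hb hxn hmag.
have [K K1 hK] := dist_kernel_bound _ _ _ (residual_rlinear n m A phi phi1).
exists (2%:R * K); first by lra.
move=> d hrad hph; have [d0 f0 hd] := hK d.
have [fA fB] : A *m scalev (radial phi (dsubmx d0)) phi = 0 /\
    A^t* *m usubmx d0 = ii *: scalev (tangential phi (dsubmx d0)) phi.
  move: f0; rewrite /residual -[X in _ = X -> _]vsubmxK => /eq_col_mx; rewrite !linear0.
  by move=> [-> /eqP]; rewrite subr_eq0 => /eqP ->.
have [t ht] := tangential_kernel _ _ A b bmin phi xn _ _ phi1 bmin0 hb hxn hmag fB.
set tau := radial phi (dsubmx d0) in fA.
have d0E : d0 = toC t *: (ii *: col_mx xn (scalev b phi)) + col_mx 0 (scalev tau phi).
  rewrite -[LHS]vsubmxK !scale_col_mx add_col_mx addr0 -ht; congr col_mx.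
  rewrite [LHS](radial_tangentialE _ phi) // addrC; congr (_ + _).
  by rewrite -fB ht -!scalemxAr hxn.
have e1 : rdot d d0 = t * rdot d (ii *: col_mx xn (scalev b phi)).
  by rewrite d0E rdotDr rdotZr hrad // addr0.
have e2 : `|t| * norm2 xn <= norm2 d0.
  apply: le_trans (_ : norm2 (usubmx d0) <= _); last first.
    by rewrite -{2}[d0]vsubmxK norm2_colu.
  by rewrite ht !norm2Z modc_real modc_i mul1r.
have e3 : norm2 d0 <= norm2 d + norm2 (d - d0).
  rewrite -{1}[d0](subKr d); exact: norm2B.
have e4 : norm2 d ^+ 2 <= norm2 d * norm2 (d - d0) + `|rdot d d0|.
  rewrite norm2_sqr -{2}[d](subrK d0) rdotDr; apply: lerD; last exact: ler_norm.
  exact: le_trans (ler_norm _) (rdot_le _ _ _).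
have e5 : `|rdot d d0| <= norm2 d0 / 4%:R * norm2 d.
  rewrite e1 normrM; apply: (@le_trans _ _ (`|t| * (norm2 xn / 4%:R * norm2 d))).
    by rewrite ler_wpM2l.
  by rewrite mulrA ler_wpM2r ?norm2_ge0 // mulrA ler_wpM2r ?invr_ge0.
set a := norm2 d in e3 e4 e5 *; set D := norm2 (d - d0) in hd e3 e4.
have a0 : 0 <= a by exact: norm2_ge0.
have : a <= 2%:R * D.
  have [a_eq|an0] := eqVneq a 0; first by rewrite a_eq mulr_ge0 ?norm2_ge0.
  have a_gt0 : 0 < a by rewrite lt_def an0.
  have e6 : norm2 d0 / 4%:R * a <= (a + D) / 4%:R * a.
    by rewrite ler_wpM2r // ler_wpM2r ?invr_ge0.
  have : a * a <= a * (D + (a + D) / 4%:R) by rewrite -expr2 mulrDr; lra.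
  have : 0 <= D by exact: norm2_ge0.
  by rewrite ler_pM2l // => ? ?; lra.
by move=> h; rewrite -mulrA; lra.
Qed.

(** * First-order optimality at a nearest fixed point *)

Lemma linear_le_quadratic {R : realType} (a c s0 : R) : 0 <= a -> 0 < s0 ->
  (forall s, `|s| <= s0 -> 2%:R * (s * c) <= s ^+ 2 * a) -> c = 0.
Proof.
move=> a0 s00 h; apply/eqP; rewrite -normr_le0 leNgt; apply/negP => c0.
have a1 : 0 < a + 1 by lra.
pose s := Num.min s0 (`|c| / (a + 1)).
have s_gt0 : 0 < s by rewrite lt_min s00 divr_gt0.
have ss0 : s <= s0 by rewrite ge_min lexx.
have sc : s * (a + 1) <= `|c| by rewrite -ler_pdivlMr // ge_min lexx orbT.
have key : 2%:R * (s * `|c|) <= s ^+ 2 * a.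
  have [cp|cn] := leP 0 c; first by rewrite ger0_norm // h // gtr0_norm.
  have := h (- s); rewrite normrN gtr0_norm // sqrrN ltr0_norm // mulrN mulNr.
  exact.
have : s * (2%:R * `|c|) <= s * (s * a) by move: key; rewrite expr2; lra.
rewrite ler_pM2l //; lra.
Qed.

Lemma nearest_orth_line {R : realType} p (S : set 'cV[R[i]]_p) (z w v : 'cV[R[i]]_p)
    (s0 : R) :
  is_argmin_dist S z w -> 0 < s0 ->
  (forall s, `|s| <= s0 -> S (w + toC s *: v)) -> rdot (z - w) v = 0.
Proof.
move=> [_ hmin] s00 hS; apply: (@linear_le_quadratic _ (rdot v v) _ s0) => //.
  exact: rdot_ge0.
move=> s /hS /hmin /norm2_le_sqr; rewrite !norm2_sqr.
have -> : w + toC s *: v - z = toC s *: v - (z - w) by rewrite opprB addrA [w + _]addrC.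
rewrite -[w - z]opprB rdotNl rdotNr opprK; move: (z - w) => d.
rewrite rdotBl !rdotBr !rdotZl !rdotZr (rdotC _ v d) expr2; lra.
Qed.

Lemma norm2B_sqr {R : realType} p (u v : 'cV[R[i]]_p) :
  norm2 (u - v) ^+ 2 = norm2 u ^+ 2 + norm2 v ^+ 2 - 2%:R * rdot u v.
Proof. by rewrite !norm2_sqr rdotBl !rdotBr (rdotC _ v u); ring. Qed.

(** Rotating [w] by the phase of the Hermitian product of [w] and [z] cannot
    bring it closer to [z], so that product is already real. *)
Lemma nearest_orth_phase {R : realType} p (S : set 'cV[R[i]]_p) (z w : 'cV[R[i]]_p) :
  is_argmin_dist S z w ->
  (forall beta : R[i], `|beta| = 1 -> S (beta *: w)) -> rdot (z - w) (ii *: w) = 0.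
Proof.
move=> [_ hmin] hS; rewrite rdotBl rdot_iZ subr0.
set a := rdot z w; set c := rdot z (ii *: w).
pose N := Num.sqrt (a ^+ 2 + c ^+ 2).
have sq0 : 0 <= a ^+ 2 + c ^+ 2 by rewrite addr_ge0 ?sqr_ge0.
have NN : N ^+ 2 = a ^+ 2 + c ^+ 2 by rewrite sqr_sqrtr.
have N0 : 0 <= N by exact: sqrtr_ge0.
have [Nz|Nn] := eqVneq N 0.
  move: NN; rewrite Nz expr0n /= => /esym/eqP.
  by rewrite paddr_eq0 ?sqr_ge0 // => /andP[_]; rewrite sqrf_eq0 => /eqP.
(* With this rotation the inner product with [z] reaches its maximum [N]. *)
pose beta : R[i] := toC (a / N) + toC (c / N) * ii.
have beta1 : `|beta| = 1.
  rewrite modcE; apply/eqP; rewrite eq_complex /= eqxx andbT.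
  rewrite !(mul0r, mulr0, mulr1, addr0, add0r, subr0) !expr_div_n -mulrDl -NN.
  by rewrite divff ?sqrtr1 // expf_neq0.
have /norm2_le_sqr := hmin _ (hS _ beta1); rewrite !norm2B_sqr.
rewrite norm2Z1 // !(rdotC _ _ z) -/a.
have -> : rdot z (beta *: w) = N.
  rewrite /beta scalerDl -scalerA rdotDr !rdotZr -/a -/c.
  have -> : a / N * a + c / N * c = (a ^+ 2 + c ^+ 2) / N by field.
  by rewrite -NN expr2 mulfK.
move=> h; have Na : N <= a by lra.
have : N ^+ 2 <= a ^+ 2 by rewrite ler_sqr ?nnegrE // (le_trans N0).
rewrite NN => h2; apply/eqP; rewrite -sqrf_eq0 eq_le sqr_ge0 andbT; lra.
Qed.

(** * One iteration *)

Definition dr_step {R : realType} {n m} (A : 'M[R[i]]_(n, m)) (b : 'cV[R]_m)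
    (z z1 : 'cV[R[i]]_(n + m)) :=
  exists2 h : 'cV[R[i]]_(n + m),
    is_orth_proj (graph A)
      (col_mx (usubmx z) (prox b (dsubmx z) - (dsubmx z - prox b (dsubmx z)))) h &
    z1 = col_mx (usubmx h) (dsubmx z - prox b (dsubmx z) + dsubmx h).

(** If [u] is the projection of [s - t], the Douglas-Rachford update [u + t]
    loses exactly the squared norm of [s - u]. *)
Lemma douglas_rachford_identity {R : realType} p (s t u : 'cV[R[i]]_p) :
  rdot (s - t - u) u = 0 ->
  norm2 (u + t) ^+ 2 = norm2 s ^+ 2 + norm2 t ^+ 2 - norm2 (s - u) ^+ 2.
Proof.
rewrite !norm2_sqr !rdotDl !rdotDr !(rdotNl, rdotNr) (rdotC _ t u) (rdotC _ u s).
lra.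
Qed.

Lemma orth_graph {R : realType} n m (A : 'M[R[i]]_(n, m)) (a : 'cV[R[i]]_(n + m)) :
  (forall v, graph A v -> v^t* *m a = 0) -> usubmx a + A *m dsubmx a = 0.
Proof.
move=> h; apply: norm2_eq0; apply/eqP.
rewrite -sqrf_eq0 norm2_sqr; apply/eqP.
set c := usubmx a + _.
have := h (col_mx c (A^t* *m c)); rewrite /graph /= col_mxKu col_mxKd => /(_ erefl) ha.
have : rdot (col_mx c (A^t* *m c)) a = 0 by rewrite rdotE ha mxE.
by rewrite -{1}[a]vsubmxK rdot_col rdot_adjoint -rdotDr.
Qed.

Lemma norm2D_sqr {R : realType} p (u v : 'cV[R[i]]_p) :
  norm2 (u + v) ^+ 2 = norm2 u ^+ 2 + norm2 v ^+ 2 + 2%:R * rdot u v.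
Proof. by rewrite !norm2_sqr rdotDl !rdotDr (rdotC _ v u); ring. Qed.

(** Energy balance of one iteration relative to a fixed point with dual offset
    [ys - yn]: the middle term vanishes for the linearised projection. *)
Lemma dr_step_energy {R : realType} n m (A : 'M[R[i]]_(n, m))
    (x x1 xn : 'cV[R[i]]_n) (w P ys : 'cV[R[i]]_m) :
  (x - x1) + A *m (P - (w - P) - A^t* *m x1) = 0 ->
  A *m (ys - A^t* *m xn) = 0 ->
  norm2 (col_mx (x1 - xn) (w - P + A^t* *m x1 - ys)) ^+ 2
    = norm2 (col_mx (x - xn) (w - ys)) ^+ 2
      - 2%:R * rdot (P - A^t* *m xn) (w - ys - (P - A^t* *m xn))
      - norm2 (col_mx (x - x1) (P - A^t* *m x1)) ^+ 2.
Proof.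
set y1 := A^t* *m x1; set yn := A^t* *m xn => a_orth ys_orth.
have uE : A^t* *m (x1 - xn) = y1 - yn by rewrite mulmxBr.
have := douglas_rachford_identity _ (col_mx (x - xn) (P - yn))
  (col_mx 0 (w - ys - (P - yn))) (col_mx (x1 - xn) (y1 - yn)).
have -> : col_mx (x - xn) (P - yn) - col_mx 0 (w - ys - (P - yn))
    - col_mx (x1 - xn) (y1 - yn)
    = col_mx (x - x1) (P - (w - P) - y1) + col_mx 0 (ys - yn).
  rewrite !opp_col_mx !add_col_mx; congr col_mx.
    by rewrite oppr0 !addr0 opprB addrA subrK.
  by move: y1 yn {a_orth ys_orth uE} => y1 yn; apply/matrixP => i j; rewrite !mxE; ring.
rewrite opp_col_mx !add_col_mx !addr0.
have -> : x - xn - (x1 - xn) = x - x1 by rewrite opprB addrA subrK.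
have -> : P - yn - (y1 - yn) = P - y1 by rewrite opprB addrA subrK.
have -> : y1 - yn + (w - ys - (P - yn)) = w - P + y1 - ys.
  by move: y1 yn {a_orth ys_orth uE} => y1 yn; apply/matrixP => i j; rewrite !mxE; ring.
move=> ->; last first.
  rewrite -uE rdotC rdot_col rdot_adjoint mulmxDr ys_orth addr0 -rdotDr a_orth.
  by rewrite rdotC rdot0l.
rewrite !norm2_col norm20.
have -> : norm2 (w - ys) = norm2 ((P - yn) + (w - ys - (P - yn))) by rewrite subrKC.
rewrite (norm2D_sqr _ (P - yn)); ring.
Qed.

Lemma tangential_error_cross {R : realType} p (u v e : 'cV[R[i]]_p) :
  rdot u v = 0 ->
  - rdot (v + e) (u + v - (v + e)) <= norm2 e * norm2 (u + v) + norm2 e ^+ 2.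
Proof.
move=> uv; have <- : norm2 (v - u) = norm2 (u + v).
  apply/eqP; rewrite -(@eqrXn2 _ 2) ?norm2_ge0 //; apply/eqP.
  by rewrite norm2B_sqr norm2D_sqr (rdotC _ v u) uv; ring.
have -> : u + v - (v + e) = u - e by rewrite opprD addrA addrK.
have -> : - rdot (v + e) (u - e) = rdot e (v - u) + norm2 e ^+ 2.
  rewrite norm2_sqr !rdotDl !rdotDr !rdotNr (rdotC _ v u) uv (rdotC _ v e); ring.
rewrite lerD2r; exact: le_trans (ler_norm _) (rdot_le _ _ _).
Qed.

Lemma le_sqrtr_mul {R : realType} (c r a : R) :
  0 <= c -> 0 <= a -> 0 <= r -> r ^+ 2 <= c * a ^+ 2 -> r <= Num.sqrt c * a.
Proof.
move=> c0 a0 r0 h; rewrite -ler_sqr ?nnegrE ?mulr_ge0 ?sqrtr_ge0 //.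
by rewrite exprMn sqr_sqrtr.
Qed.

(** * Contraction towards a nearest point of phase one *)

(** [a], [G], [E] stand for the norms of the displacement, of the lost
    component and of the projection error.  As [E] is at most [kappa * a] with
    [kappa * K] small, coercivity gives [a <= 2 * K * G], so the loss [G ^+ 2]
    dominates the terms in [E]. *)
Lemma contraction_numerics {R : realType} (K kappa a G E r : R) :
  1 <= K -> 0 <= a -> 0 <= G -> 0 <= E ->
  0 <= kappa -> kappa * (48%:R * K ^+ 2) <= 1 -> E <= kappa * a -> a <= K * (G + E) ->
  r <= a ^+ 2 + 2%:R * (E * a + E ^+ 2) - G ^+ 2 ->
  r <= (1 - (8%:R * K ^+ 2)^-1) * a ^+ 2.
Proof.
move=> K1 a0 G0 E0 k0 kK Ea aK /le_trans; apply.
have K0 : 0 < K by lra.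
have KK : K <= K ^+ 2 by rewrite expr2 ler_peMl // ltW.
pose q := (K ^+ 2)^-1; have q0 : 0 < q by rewrite invr_gt0 exprn_gt0.
have qK : K ^+ 2 * q = 1 by rewrite divff // expf_neq0 // gt_eqF.
have kq : 48%:R * kappa <= q.
  have : kappa * (48%:R * K ^+ 2) * q <= 1 * q by rewrite ler_wpM2r // ltW.
  have -> : kappa * (48%:R * K ^+ 2) * q = 48%:R * kappa * (K ^+ 2 * q) by ring.
  by rewrite qK mulr1 mul1r.
have k1 : kappa <= 1.
  have : kappa * 48%:R <= kappa * (48%:R * K ^+ 2).
    by rewrite ler_wpM2l //; lra.
  lra.
have Ka : a <= 2%:R * (K * G).
  have h1 : K * E <= K * (kappa * a) by rewrite ler_wpM2l // ltW.
  have h2 : K * (kappa * a) <= K ^+ 2 * (kappa * a).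
    by rewrite ler_wpM2r // mulr_ge0.
  have h3 : kappa * (48%:R * K ^+ 2) * a <= 1 * a by rewrite ler_wpM2r.
  have h4 : kappa * (48%:R * K ^+ 2) * a = 48%:R * (K ^+ 2 * (kappa * a)) by ring.
  by rewrite h4 in h3; move: aK; rewrite mulrDr; lra.
have aG : q * a ^+ 2 <= 4%:R * G ^+ 2.
  have : a ^+ 2 <= (2%:R * (K * G)) ^+ 2.
    by rewrite ler_sqr // nnegrE // !mulr_ge0 // ltW.
  move=> /(ler_wpM2l (ltW q0)).
  have -> : q * (2%:R * (K * G)) ^+ 2 = 4%:R * (K ^+ 2 * q) * G ^+ 2 by ring.
  by rewrite qK mulr1.
have a20 : 0 <= a ^+ 2 by exact: sqr_ge0.
have e1 : E * a <= kappa * a ^+ 2 by rewrite expr2 mulrA ler_wpM2r.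
have e2 : E ^+ 2 <= kappa * a ^+ 2.
  apply: (@le_trans _ _ ((kappa * a) ^+ 2)).
    by rewrite ler_sqr // nnegrE // mulr_ge0.
  by rewrite exprMn ler_wpM2r // expr2 -[leRHS]mulr1 ler_wpM2l.
have e3 : 48%:R * kappa * a ^+ 2 <= q * a ^+ 2 by rewrite ler_wpM2r.
have e4 : 0 <= q * a ^+ 2 by rewrite mulr_ge0 // ltW.
rewrite invfM -/q mulrBl mul1r; lra.
Qed.

Section UnitPhase.

Context {R : realType} {n m : nat} (A : 'M[R[i]]_(n, m)) (b : 'cV[R]_m) (bmin : R).
Context (xn : 'cV[R[i]]_n).
Let yn := A^t* *m xn.
Let phi := phasev yn.
Hypothesis bmin_gt0 : 0 < bmin.
Hypothesis bminP : forall i, bmin <= b i 0.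
Hypothesis absvyn : absv yn = b.
Hypothesis magnitude_retrieval : forall x : 'cV[R[i]]_n,
  (forall i, phasev (A^t* *m x) i 0 = phasev (A^t* *m xn) i 0) ->
  exists c : R, x = toC c *: xn.

Let F := calF A b xn yn.

Lemma modc_yn i : modc (yn i 0) = b i 0.
Proof. by rewrite -absvyn [RHS]mxE. Qed.

Lemma b_gt0 i : 0 < b i 0.
Proof. exact: lt_le_trans (bminP i). Qed.

Lemma toC_neq0 (s : R) : s != 0 -> toC s != 0 :> R[i].
Proof. by move=> s0; rewrite eq_complex /= eqxx andbT. Qed.

Lemma phi_unimodular : unimodular phi.
Proof.
move=> i; rewrite mxE normrM normfV normr_id divff // modcE modc_yn.
by rewrite toC_neq0 // gt_eqF // b_gt0.
Qed.

Lemma yn_phi : yn = scalev b phi.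
Proof.
apply/matrixP => i j; rewrite (ord1 j) scalevE [phi i 0]mxE modcE modc_yn mulrC divfK //.
by rewrite toC_neq0 // gt_eqF // b_gt0.
Qed.

Definition unit_point (theta : 'cV[R]_m) := col_mx xn (scalev (b + theta) phi).

Lemma unit_point_mem theta :
  A *m scalev theta phi = 0 -> (forall i, 0 <= (b + theta) i 0) -> F (unit_point theta).
Proof.
move=> Ath bth; exists 1, theta; split=> //; first exact: normr1.
by rewrite !scale1r.
Qed.

Lemma calF_rotate (alpha : R[i]) w : `|alpha| = 1 -> F w -> F (alpha *: w).
Proof.
move=> a1 [c [theta [c1 Ath bth ->]]]; exists (alpha * c), theta; split=> //.
  by rewrite normrM a1 c1 mulr1.
by rewrite scale_col_mx !scalerA.
Qed.

Lemma abs_le_norm2_scalev (tau : 'cV[R]_m) i : `|tau i 0| <= norm2 (scalev tau phi).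
Proof.
apply: le_trans (modc_le_norm2 _ _ i); rewrite scalevE.
by rewrite ComplexField.Normc.normcM modc_real (modc1 _ (phi_unimodular i)) mulr1.
Qed.

(** The positivity constraint of [calF] is inactive near the solution, so small
    dual moves in both directions are admissible competitors. *)
Lemma nearest_orth_radial z theta tau :
  is_argmin_dist F z (unit_point theta) -> A *m scalev theta phi = 0 ->
  norm2 (scalev theta phi) <= bmin / 2%:R -> A *m scalev tau phi = 0 ->
  rdot (z - unit_point theta) (col_mx 0 (scalev tau phi)) = 0.
Proof.
move=> hz Ath thb Atau.
pose M := 1 + norm2 (scalev tau phi).
have M0 : 0 < M by have := norm2_ge0 _ (scalev tau phi); rewrite /M; lra.
apply: (nearest_orth_line _ F z _ _ (bmin / 2%:R / M)) => //.
  by rewrite !divr_gt0.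
move=> s hs.
have -> : unit_point theta + toC s *: col_mx 0 (scalev tau phi) = unit_point (theta + s *: tau).
  rewrite /unit_point scale_col_mx scaler0 add_col_mx addr0 addrA.
  by rewrite [in RHS]scalevD scalevZ.
apply: unit_point_mem.
  by rewrite scalevD scalevZ mulmxDr -scalemxAr Ath Atau scaler0 addr0.
move=> i; rewrite !mxE.
have h1 := le_trans (abs_le_norm2_scalev theta i) thb.
have h2 : `|s * tau i 0| <= bmin / 2%:R.
  rewrite normrM; apply: (@le_trans _ _ (bmin / 2%:R / M * M)).
    apply: ler_pM => //; apply: le_trans (abs_le_norm2_scalev tau i) _.
    by rewrite /M lerDr.
  by rewrite divfK // gt_eqF.
have h3 := bminP i.
have := ler_norm (- theta i 0); have := ler_norm (- (s * tau i 0)).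
by rewrite !normrN; lra.
Qed.

(** To first order [prox b] keeps the tangential part of a displacement. *)
Lemma prox_expansion (theta : 'cV[R]_m) (w : 'cV[R[i]]_m) (s : R) :
  norm2 (scalev theta phi) + norm2 (w - scalev (b + theta) phi) <= s ->
  s <= bmin / 2%:R ->
  norm2 (prox b w - yn - ii *: scalev (tangential phi (w - scalev (b + theta) phi)) phi)
    <= 6%:R * s / bmin * norm2 (w - scalev (b + theta) phi).
Proof.
set eta := w - scalev (b + theta) phi => hs sb.
have s0 : 0 <= s by apply: le_trans hs; rewrite addr_ge0 ?norm2_ge0.
apply: norm2_le_entries => [|i].
  by rewrite divr_ge0 ?mulr_ge0 ?(ltW bmin_gt0).
have ph := phi_unimodular i; have bi := bminP i; have bi0 := b_gt0 i.
pose h : R[i] := conjc (phi i 0) * eta i 0.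
have eh : modc h = modc (eta i 0).
  by rewrite ComplexField.Normc.normcM (@modc1 _ (conjc _)) ?mul1r // normcJ.
have wE : w i 0 = phi i 0 * (toC ((b + theta) i 0) + h).
  have -> : phi i 0 * (toC ((b + theta) i 0) + h)
      = toC ((b + theta) i 0) * phi i 0 + phi i 0 * conjc (phi i 0) * eta i 0.
    by rewrite /h; ring.
  rewrite unimodular_mulJ // mul1r [eta i 0]mxE [(- scalev _ _) _ _]mxE scalevE.
  by rewrite [RHS]addrC subrK.
have := circle_projection_expansion (phi i 0) h (b i 0) ((b + theta) i 0) s ph bi0.
rewrite -wE eh => key.
have -> : (prox b w - yn - ii *: scalev (tangential phi eta) phi) i 0
  = toC (b i 0) * (w i 0 / `|w i 0|) - toC (b i 0) * phi i 0
    - phi i 0 * (toC (im h) * ii).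
  rewrite [LHS]mxE [(_ - yn) i 0]mxE [(- yn) i 0]mxE [(- (_ *: scalev _ _)) i 0]mxE yn_phi.
  rewrite !scalevE [phasev w i 0]mxE; congr (_ - _).
  by rewrite [LHS]mxE scalevE [tangential _ _ _ _]mxE -/h; ring.
apply: le_trans (key _ _) _.
- apply: le_trans hs; apply: lerD; last exact: modc_le_norm2.
  have -> : (b + theta) i 0 - b i 0 = theta i 0 by rewrite mxE addrC addKr.
  exact: abs_le_norm2_scalev.
- by apply: le_trans sb _; rewrite ler_pM2r ?invr_gt0.
- rewrite ler_wpM2r ?modc_ge0 // ler_wpM2l ?mulr_ge0 //.
  by rewrite lef_pV2 ?posrE.
Qed.

(** The energy balance loses the squared norm of [g].  The residual of the
    displacement is a linear image of [g] up to the projection error, so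
    coercivity turns that loss into a fixed fraction of the squared
    displacement. *)
Lemma unit_phase_contraction : 0 < norm2 xn -> exists rho gamma : R,
  [/\ 0 < rho, 0 < gamma, gamma < 1 & forall z z1 theta,
    dr_step A b z z1 -> A *m scalev theta phi = 0 ->
    is_argmin_dist F z (unit_point theta) ->
    norm2 (scalev theta phi) <= rho -> norm2 (z - unit_point theta) <= rho ->
    norm2 (z1 - unit_point theta) <= gamma * norm2 (z - unit_point theta)].
Proof.
move=> xn_gt0; have phi1 := phi_unimodular.
have [K0 K01 coercive] := residual_coercive _ _ A b bmin phi xn phi1 bmin_gt0 bminP yn_phi
  magnitude_retrieval.
(* The residual of the displacement will be [fG g + fE e]. *)
pose fG (g : 'cV[R[i]]_(n + m)) : 'cV[R[i]]_(n + m) :=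
  col_mx (usubmx g + A *m dsubmx g) (A^t* *m usubmx g - dsubmx g).
pose fE (e : 'cV[R[i]]_m) : 'cV[R[i]]_(n + m) := col_mx (A *m e) e.
have [KG KG1 fGb] : exists2 K : R, 1 <= K & forall g, norm2 (fG g) <= K * norm2 g.
  apply: rlinear_bounded => s u v; rewrite /fG scale_col_mx add_col_mx !linearD !linearZ /=.
  by congr col_mx; exact: addrACA.
have [KE KE1 fEb] : exists2 K : R, 1 <= K & forall e, norm2 (fE e) <= K * norm2 e.
  apply: rlinear_bounded => s u v; rewrite /fE scale_col_mx add_col_mx.
  by rewrite mulmxDr -scalemxAr.
have [K K1 KP] : exists2 K : R, 1 <= K & forall a e, 0 <= a -> 0 <= e ->
    K0 * (KG * a + KE * e) <= K * (a + e).
  exists (K0 * (KG + KE)).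
    apply: (@le_trans _ _ (K0 * 1)); first by rewrite mulr1.
    by rewrite ler_pM2l; lra.
  move=> a e a0 e0; rewrite -mulrA ler_pM2l; last by lra.
  have : 0 <= KG * e by rewrite mulr_ge0 //; lra.
  have : 0 <= KE * a by rewrite mulr_ge0 //; lra.
  by rewrite mulrDl !mulrDr; lra.
have KK1 : 1 <= K ^+ 2 by rewrite exprn_ege1.
(* [576 = 12 * 48]: the expansion error factor is [12 * rho / bmin], and it has
   to stay below [(48 * K ^+ 2)^-1]. *)
have KK0 : 0 < 576%:R * K ^+ 2 by lra.
have [rho [rho0 rhoK rhox]] : exists rho : R,
    [/\ 0 < rho, rho * (576%:R * K ^+ 2) <= bmin & rho <= norm2 xn / 4%:R].
  exists (Num.min (bmin / (576%:R * K ^+ 2)) (norm2 xn / 4%:R)); split.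
  - by rewrite lt_min !divr_gt0.
  - by rewrite -ler_pdivlMr // ge_min lexx.
  - by rewrite ge_min lexx orbT.
have rhob : rho * 576%:R <= bmin.
  by apply: le_trans rhoK; rewrite ler_pM2l //; lra.
have rhob2 : rho <= bmin / 2%:R by lra.
have rhob4 : 2%:R * rho <= bmin / 2%:R by lra.
have q0 : 0 < (8%:R * K ^+ 2)^-1 by rewrite invr_gt0; lra.
have q1 : (8%:R * K ^+ 2)^-1 < 1 by rewrite invf_lt1; lra.
have kappa0 : 0 <= 12%:R * rho / bmin by rewrite divr_ge0 ?mulr_ge0 ?ltW.
have kappaK : 12%:R * rho / bmin * (48%:R * K ^+ 2) <= 1.
  have -> : 12%:R * rho / bmin * (48%:R * K ^+ 2) = rho * (576%:R * K ^+ 2) / bmin by ring.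
  by rewrite ler_pdivrMr // mul1r.
have K00 : 0 <= K0 by lra.
exists rho, (Num.sqrt (1 - (8%:R * K ^+ 2)^-1)); split=> //.
- by rewrite sqrtr_gt0 subr_gt0.
- by rewrite -[ltRHS]sqrtr1 ltr_sqrt // ltrBlDr ltrDl.
move=> z z1 theta [h [hgraph horth] z1E] Ath hz thr dr.
pose x := usubmx z; pose w := dsubmx z; pose P := prox b w.
pose x1 := usubmx h; pose y1 := dsubmx h.
have y1E : y1 = A^t* *m x1 by [].
pose ys := scalev (b + theta) phi.
have ysE : ys = yn + scalev theta phi by rewrite /ys scalevD -yn_phi.
pose eta := w - ys; pose delta := P - yn.
pose e := delta - ii *: scalev (tangential phi eta) phi.
pose d := col_mx (x - xn) eta.
have dE : z - unit_point theta = d.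
  by rewrite -[z]vsubmxK /unit_point opp_col_mx add_col_mx.
have rE : z1 - unit_point theta = col_mx (x1 - xn) (w - P + y1 - ys).
  by rewrite z1E /unit_point opp_col_mx add_col_mx.
rewrite dE in dr *; rewrite rE.
pose g := col_mx (x - x1) (P - y1).
have a_orth := orth_graph _ _ A _ horth.
have {}a_orth : (x - x1) + A *m (P - (w - P) - y1) = 0.
  move: a_orth; rewrite -{1 2}[h]vsubmxK opp_col_mx add_col_mx col_mxKu col_mxKd.
  by rewrite -/x -/w -/P -/x1 -/y1.
have eta_d : norm2 eta <= norm2 d by exact: norm2_cold.
have e_small : norm2 e <= 12%:R * rho / bmin * norm2 d.
  apply: (@le_trans _ _ (12%:R * rho / bmin * norm2 eta)); last by rewrite ler_wpM2l.
  have -> : 12%:R * rho / bmin = 6%:R * (2%:R * rho) / bmin by ring.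
  apply: prox_expansion rhob4.
  apply: le_trans (lerD thr (le_trans eta_d dr)) _.
  by rewrite mulr_natl mulr2n.
have ys_orth : A *m (ys - yn) = 0 by rewrite ysE [yn + _]addrC addrK.
have := dr_step_energy _ _ A x x1 xn w P ys.
rewrite -y1E => /(_ a_orth ys_orth) identity.
have resE : residual A phi d = fG g + fE e.
  rewrite /residual /fG /fE col_mxKu !col_mxKd col_mxKu add_col_mx; congr col_mx.
    have -> : scalev (radial phi eta) phi = eta - delta + e.
      by rewrite /e addrA subrK {2}(radial_tangentialE _ phi eta phi1) addrK.
    rewrite mulmxDr; congr (_ + _).
    have -> : eta - delta = w - P - scalev theta phi.
      rewrite /eta /delta ysE opprB [yn + scalev _ _]addrC opprD !addrA subrK.
      by rewrite addrAC.
    have -> : x - x1 = A *m (w - P - (P - y1)).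
      move/eqP: a_orth; rewrite addr_eq0 => /eqP ->; rewrite -mulmxN; congr (_ *m _).
      by rewrite [P - (w - P) - y1]addrAC opprB.
    by rewrite -mulmxDr subrK mulmxBr Ath subr0.
  by rewrite /e /delta !mulmxBr -y1E opprB !addrA !subrK.
have coer : norm2 d <= K0 * norm2 (residual A phi d).
  apply: coercive => [tau Atau|].
    rewrite -dE; apply: nearest_orth_radial => //.
    exact: le_trans rhob2.
  (* Orthogonality holds for the phase direction at the nearest point; its
     difference from the one at the solution is the dual offset. *)
  have hp : rdot d (ii *: unit_point theta) = 0.
    rewrite -dE; apply: (nearest_orth_phase _ F) => // beta b1.
    by apply: calF_rotate => //; case: hz.
  have -> : col_mx xn (scalev b phi) = unit_point theta - col_mx 0 (scalev theta phi).
    rewrite opp_col_mx add_col_mx oppr0 addr0; congr col_mx.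
    by rewrite scalevD addrK.
  rewrite scalerBr rdotBr hp sub0r normrN mulrC; apply: le_trans (rdot_le _ _ _) _.
  rewrite ler_wpM2l ?norm2_ge0 // norm2Z modc_i mul1r.
  apply: le_trans (_ : norm2 (scalev theta phi) <= _); last exact: le_trans thr _.
  rewrite -ler_sqr ?nnegrE ?norm2_ge0 // norm2_col norm20 expr0n /= add0r //.
have cross : - rdot delta (eta - delta) <= norm2 e * norm2 d + norm2 e ^+ 2.
  have := tangential_error_cross _ (scalev (radial phi eta) phi)
    (ii *: scalev (tangential phi eta) phi) e (rdot_radial_tangential _ _ _ _).
  rewrite -(radial_tangentialE _ phi eta phi1) [_ + e]subrKC => h1.
  by apply: le_trans h1 _; rewrite lerD2r ler_wpM2l ?norm2_ge0.
apply: le_sqrtr_mul; rewrite ?norm2_ge0 ?subr_ge0 ?(ltW q1) //.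
apply: (contraction_numerics K _ (norm2 d) (norm2 g) (norm2 e) _ K1 _ _ _ kappa0 kappaK
  e_small); rewrite ?norm2_ge0 //.
- apply: le_trans coer _; apply: le_trans (KP _ _ (norm2_ge0 _ _) (norm2_ge0 _ _)).
  apply: ler_wpM2l K00 _ _ _; rewrite resE.
  by apply: le_trans (norm2D _ _ _) _; apply: lerD.
- rewrite identity lerD2r lerD2l -mulrN; exact: ler_wpM2l cross.
Qed.

(** * Invariance under the global phase *)

Lemma prox_rotate (c : R[i]) (w : 'cV[R[i]]_m) :
  `|c| = 1 -> prox b (c *: w) = c *: prox b w.
Proof.
move=> c1; apply/matrixP => i j; rewrite !mxE normrM c1 mul1r.
ring.
Qed.

Lemma dr_step_rotate (c : R[i]) z z1 :
  `|c| = 1 -> dr_step A b z z1 -> dr_step A b (c *: z) (c *: z1).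
Proof.
move=> c1 [h [hgraph horth] ->]; exists (c *: h).
  split; first by rewrite /graph /= !linearZ /= -hgraph.
  move=> v /horth; rewrite !linearZ /= prox_rotate // -!scalerBr -scale_col_mx.
  by rewrite -scalerDr -scalemxAr => ->; rewrite scaler0.
by rewrite !linearZ /= prox_rotate // -scalerBr -scalerDr -scale_col_mx.
Qed.

Lemma nearest_rotate (c : R[i]) z w :
  `|c| = 1 -> is_argmin_dist F z w -> is_argmin_dist F (c *: z) (c *: w).
Proof.
move=> c1 [Fw hmin]; split; first exact: calF_rotate.
move=> v Fv; have cc := unimodular_mulJ c c1.
have cJ1 : `|conjc c| = 1 by rewrite normcJ.
have -> : v = c *: (conjc c *: v) by rewrite scalerA cc scale1r.
by rewrite -!scalerBr !norm2Z1 //; apply/hmin/calF_rotate.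
Qed.

(** Entrywise this is the reverse triangle inequality, since [b + theta] is the
    modulus of the measurement part of the point. *)
Lemma dual_offset_le (alpha : R[i]) (theta : 'cV[R]_m) :
  `|alpha| = 1 -> (forall i, 0 <= (b + theta) i 0) ->
  norm2 (scalev theta phi) <= norm2 (alpha *: unit_point theta - col_mx xn yn).
Proof.
move=> a1 bth; rewrite scale_col_mx opp_col_mx add_col_mx.
apply: le_trans (norm2_cold _ _ _ _); rewrite -[leRHS]mul1r.
apply: norm2_le_entries => // i; rewrite mul1r.
have ph := modc1 _ (phi_unimodular i).
have -> : modc (scalev theta phi i 0) = `|theta i 0|.
  by rewrite scalevE ComplexField.Normc.normcM modc_real ph mulr1.
rewrite [_ i 0 in leRHS]mxE [(_ *: scalev _ _) i 0]mxE [(- yn) i 0]mxE scalevE.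
set u := alpha * _.
have uE : modc u = b i 0 + theta i 0.
  rewrite /u !ComplexField.Normc.normcM modc_real ph (modc1 _ a1) mul1r mulr1.
  by rewrite ger0_norm ?bth // mxE.
have yE := modc_yn i.
have h1 := le_normcD (u - yn i 0) (yn i 0).
have h2 := le_normcD (- (u - yn i 0)) u.
rewrite normcN opprB subrK yE uE in h2; rewrite subrK yE uE in h1.
by rewrite ler_norml; apply/andP; split; lra.
Qed.

Lemma dr_step_contraction : 0 < norm2 xn -> exists rho gamma : R,
  [/\ 0 < rho, 0 < gamma, gamma < 1 & forall z z1 zs,
    dr_step A b z z1 -> is_argmin_dist F z zs ->
    norm2 (zs - col_mx xn yn) <= rho -> norm2 (z - zs) <= rho ->
    norm2 (z1 - zs) <= gamma * norm2 (z - zs)].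
Proof.
move=> xn0; have [rho [gamma [rho0 g0 g1 H]]] := unit_phase_contraction xn0.
exists rho, gamma; split=> // z z1 zs st hz.
have [[alpha [theta [a1 Ath bth zsE]]] _] := hz.
rewrite -scale_col_mx -/(unit_point theta) in zsE => hs hd.
have cJ1 : `|conjc alpha| = 1 by rewrite normcJ.
have zsE' : unit_point theta = conjc alpha *: zs.
  by rewrite zsE scalerA mulrC unimodular_mulJ // scale1r.
rewrite -(norm2Z1 _ (conjc alpha) (z1 - zs)) // -(norm2Z1 _ (conjc alpha) (z - zs)) //.
rewrite !scalerBr -zsE'; apply: H => //.
- exact: dr_step_rotate.
- by rewrite zsE'; exact: nearest_rotate.
- by apply: le_trans hs; rewrite zsE; exact: dual_offset_le.
- by rewrite zsE' -scalerBr norm2Z1.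
Qed.

End UnitPhase.

(** * Convergence of the iteration *)

(** After the first step the primal multiplier vanishes, and the sum of primal
    and dual variables follows the Douglas-Rachford recursion. *)
Lemma GPS_dr_step {R : realType} n m (A : 'M[R[i]]_(n, m)) (b : 'cV[R]_m) x y lam nu k :
  GPS A b x y lam nu -> lam k.+1 = 0 /\
  dr_step A b (col_mx (lam k.+1 + x k.+1) (nu k.+1 + y k.+1))
              (col_mx (lam k.+2 + x k.+2) (nu k.+2 + y k.+2)).
Proof.
move=> [xh [yh H]].
have lam0 j : lam j.+1 = 0.
  by have [_ xE _ -> _] := H j; rewrite xE [xh j + _]addrC subrr.
split=> //; rewrite !lam0 !add0r.
have [_ _ yE _ nuE] := H k.
have [proj xE' _ _ nuE'] := H k.+1.
have wE : nu k.+1 + y k.+1 = nu k + yh k by rewrite nuE subrK.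
have PE : prox b (nu k.+1 + y k.+1) = y k.+1 by rewrite wE yE addrC.
exists (col_mx (xh k.+1) (yh k.+1)); rewrite !(col_mxKu, col_mxKd) PE addrK.
  by move: proj; rewrite lam0 subr0.
by rewrite nuE' subrK xE' lam0 addr0.
Qed.

Theorem theorem3p5 (R : realType) (n m : nat) (hnm : (n <= m)%N)
  (A : 'M[R[i]]_(n, m)) (b : 'cV[R]_m)
  (bmin : R) (hbmin : is_min_entry b bmin) (hbmin_pos : 0 < bmin)
  (G : finZmodType) (pos : 'I_n -> G) (hpos : bijective pos)
  (xn : 'cV[R[i]]_n) (yn : 'cV[R[i]]_m)
  (hyn : yn = A^t* *m xn) (hxn : absv yn = b)
  (hA : Assumption1 A b pos xn)
  (PF : 'cV[R[i]]_(n + m) -> 'cV[R[i]]_(n + m))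
  (hPF : forall z, is_argmin_dist (calF A b xn yn) z (PF z)) :
  exists eps3 : R,
    [/\ 0 < eps3, eps3 < bmin / 6%:R &
      forall (x : nat -> 'cV[R[i]]_n) (y : nat -> 'cV[R[i]]_m)
             (lam : nat -> 'cV[R[i]]_n) (nu : nat -> 'cV[R[i]]_m),
        GPS A b x y lam nu ->
        let zDR := fun k : nat => col_mx (lam k + x k) (nu k + y k) in
        norm2 (zDR 1%N - col_mx xn yn) <= eps3 ->
        exists gamma : R,
          [/\ 0 < gamma, gamma < 1 &
            forall k : nat, (1 <= k)%N ->
              phase_dist (x k) xn
                <= gamma ^+ k.-1 * norm2 (zDR 1%N - PF (zDR 1%N)) /\
              gamma ^+ k.-1 * norm2 (zDR 1%N - PF (zDR 1%N))
                <= gamma ^+ k.-1 * norm2 (zDR 1%N - col_mx xn yn)]].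
Proof.
have [[i0 bi0] bminP] := hbmin.
subst yn; set zn := col_mx xn _; set F := calF _ _ _ _ in hPF.
have magnitude_retrieval : forall u : 'cV[R[i]]_n,
    (forall i, phasev (A^t* *m u) i 0 = phasev (A^t* *m xn) i 0) ->
    exists c : R, u = toC c *: xn.
  move=> u hu; have [] := (magnitude_unique hA u).1.
    by move=> i; left; exact: hu.
  by move=> c _ ->; exists c.
have xn0 : 0 < norm2 xn.
  rewrite lt_def norm2_ge0 andbT; apply/eqP => /norm2_eq0 x0.
  move: hbmin_pos; rewrite -bi0 -(modc_yn A b xn hxn) x0 mulmx0 mxE.
  by rewrite ComplexField.Normc.normc0 ltxx.
have [rho [gamma [rho0 g0 g1 contraction]]] :=
  dr_step_contraction A b bmin xn hbmin_pos bminP hxn magnitude_retrieval xn0.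
(* [E + K * D] is the nonincreasing quantity, because
   [2 * gamma + K * gamma <= K]. *)
have [K K2 Kg] : exists2 K : R, 2%:R <= K & 2%:R + K * gamma = K.
  exists (2%:R / (1 - gamma)); last by field; rewrite subr_eq0 gt_eqF.
  by rewrite ler_pdivlMr; lra.
have K0 : 0 < 2%:R + K by lra.
have K_ge0 : 0 <= K by lra.
have K_ge1 : 1 <= K by lra.
exists (Num.min (bmin / 12%:R) (rho / (2%:R + K))); split.
- by rewrite lt_min !divr_gt0.
- by rewrite gt_min; apply/orP; left; lra.
move=> x y lam nu hG zDR; rewrite le_min => /andP[_ hz].
have {}hz : norm2 (zDR 1%N - zn) * (2%:R + K) <= rho by rewrite -ler_pdivlMr.
pose D k := norm2 (zDR k - PF (zDR k)); pose E k := norm2 (PF (zDR k) - zn).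
have D0 k : 0 <= D k by exact: norm2_ge0.
have E0 k : 0 <= E k by exact: norm2_ge0.
have near v k : F v -> D k <= norm2 (zDR k - v).
  by move=> Fv; rewrite /D norm2BC (norm2BC _ (zDR k) v); apply: (hPF _).2.
have Fzn : F zn.
  exists 1, 0; split.
  - exact: normr1.
  - by apply/matrixP => i j; rewrite !mxE big1 // => l _; rewrite !mxE mul0r mulr0.
  - by move=> i; rewrite addr0 (le_trans (ltW hbmin_pos)).
  - by rewrite addr0 !scale1r -(yn_phi A b bmin xn hbmin_pos bminP hxn).
have D1 : D 1%N <= norm2 (zDR 1%N - zn) by exact: near.
have inv k : D k.+1 <= gamma ^+ k * D 1%N /\ E k.+1 + K * D k.+1 <= rho.
  elim: k => [|k [IH1 IH2]].
    rewrite expr0 mul1r; split=> //; apply: le_trans hz.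
    have : E 1%N <= D 1%N + norm2 (zDR 1%N - zn).
      by rewrite /D norm2BC; exact: norm2_triangle.
    have : K * D 1%N <= K * norm2 (zDR 1%N - zn) by rewrite ler_wpM2l.
    by rewrite mulrDr mulrC; lra.
  have KD : D k.+1 <= K * D k.+1 by rewrite ler_peMl.
  have st : norm2 (zDR k.+2 - PF (zDR k.+1)) <= gamma * D k.+1.
    have := E0 k.+1; have := D0 k.+1 => D0k E0k.
    apply: contraction => //; first by have [] := GPS_dr_step _ _ _ _ _ _ _ _ k hG.
    - by rewrite -/(E k.+1); lra.
    - by rewrite -/(D k.+1); lra.
  have Dk : D k.+2 <= gamma * D k.+1.
    by apply: le_trans st; apply: near; exact: (hPF _).1.
  split.
    by rewrite exprS -mulrA; apply: le_trans Dk _; rewrite ler_pM2l.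
  have h1 : E k.+2 <= D k.+2 + norm2 (zDR k.+2 - zn).
    by rewrite /D norm2BC; exact: norm2_triangle.
  have h2 : norm2 (zDR k.+2 - zn) <= norm2 (zDR k.+2 - PF (zDR k.+1)) + E k.+1.
    exact: norm2_triangle.
  have h3 : K * D k.+2 <= K * (gamma * D k.+1) by rewrite ler_wpM2l.
  have h4 : K * D k.+1 = 2%:R * D k.+1 + K * (gamma * D k.+1).
    by rewrite -{1}Kg mulrDl mulrA.
  have h5 : gamma * D k.+1 <= D k.+1 by rewrite ler_piMl // ltW.
  lra.
exists gamma; split=> // -[//|k] _; rewrite succnK; split; last first.
  by rewrite ler_wpM2l // exprn_ge0 // ltW.
have [IH _] := inv k; apply: le_trans IH.
have [alpha [theta [a1 _ _ PE]]] := (hPF (zDR k.+1)).1.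
apply: (@le_trans _ _ (norm2 (x k.+1 - alpha *: xn))).
  apply: ge_inf; last by exists alpha.
  by exists 0 => _ [c _ <-]; exact: norm2_ge0.
have [lam0 _] := GPS_dr_step _ _ _ _ _ _ _ _ k hG.
rewrite /D PE /zDR lam0 add0r opp_col_mx add_col_mx; exact: norm2_colu.
Qed.
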